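(* Let $\Sigma$ be a finite group and $A$ a pseudofield. The following are equivalent: (1) $A$ is difference closed; (2) for every pseudofield $B$ which is a difference finitely generated $A$-algebra, the structure map $A\to B$ is an isomorphism (i.e. $B$ coincides with $A$); (3) for every pseudofield $B$ which is difference generated over $A$ by a single element, the structure map $A\to B$ is an isomorphism; (4) $A$ is isomorphic (as a difference ring) to $\operatorname{Fun}K$ for some algebraically closed field $K$.
   Context: A difference ring is a commutative ring with identity with an action of the group $\Sigma$ by ring automorphisms; difference homomorphisms are unital ring homomorphisms commuting with the actions; difference ideals are $\Sigma$-stable ideals. A pseudofield is an absolutely flat difference ring with no difference ideals other than $0$ and itself. For a difference ring $A$, the difference polynomial ring $A\{y_1,\dots,y_n\}$ is the polynomial ring over $A$ in indeterminates $\sigma y_i$ ($\sigma\in\Sigma$), with $\Sigma$ acting on coefficients and by $\tau(\sigma y_i)=(\tau\sigma)y_i$; a difference $A$-algebra $B$ (difference ring with difference homomorphism $A\to B$) is difference finitely generated (resp. difference generated by one element) if it is a quotient of $A\{y_1,\dots,y_n\}$ (resp. $A\{y\}$) by a difference ideal. For $a\in A^n$, $f(a)$ is given by $\sigma y_i\mapsto\sigma(a_i)$; $V(E)$ is the set of common zeros in $A^n$ of $E$, and $I(X)$ the set of difference polynomials vanishing on $X\subseteq A^n$. A pseudofield $A$ is difference closed if $\mathfrak r(\mathfrak a)=I(V(\mathfrak a))$ for every $n$ and every difference ideal $\mathfrak a\subseteq A\{y_1,\dots,y_n\}$ ($\mathfrak r$ = radical). $\operatorname{Fun}K$ is the ring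 of functions $\Sigma\to K$ with pointwise operations and $(\sigma f)(\tau)=f(\sigma^{-1}\tau)$. *)

(* Defs.v *)
From HB Require Import structures.
From mathcomp Require Import all_boot all_order all_algebra all_fingroup.
Set Implicit Arguments. Unset Strict Implicit. Unset Printing Implicit Defensive.
Import GRing.Theory.
Local Open Scope ring_scope.

Definition ring_hom (R S : comNzRingType) (f : R -> S) : Prop :=
  [/\ forall x y, f (x + y) = f x + f y,
      forall x y, f (x * y) = f x * f y & f 1 = 1].

Definition is_ideal (R : comNzRingType) (I : R -> Prop) : Prop :=
  [/\ I 0, forall x y, I x -> I y -> I (x + y) & forall r x, I x -> I (r * x)].

Definition radical (R : comNzRingType) (I : R -> Prop) : R -> Prop :=
  fun f => exists k : nat, I (f ^+ k).

Definition diff_action (gT : finGroupType) (R : comNzRingType)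
  (act : gT -> R -> R) : Prop :=
  [/\ forall g, ring_hom (act g),
      forall x, act 1%g x = x &
      forall g h x, act (g * h)%g x = act g (act h x)].

Definition diff_hom (gT : finGroupType) (R S : comNzRingType)
  (actR : gT -> R -> R) (actS : gT -> S -> S) (f : R -> S) : Prop :=
  ring_hom f /\ forall g x, f (actR g x) = actS g (f x).

Definition diff_ideal (gT : finGroupType) (R : comNzRingType)
  (act : gT -> R -> R) (I : R -> Prop) : Prop :=
  is_ideal I /\ forall g x, I x -> I (act g x).

(* absolutely flat = von Neumann regular (for commutative rings) *)
Definition abs_flat (R : comNzRingType) : Prop :=
  forall a : R, exists b : R, a = a * a * b.

Definition pseudofield (gT : finGroupType) (R : comNzRingType)
  (act : gT -> R -> R) : Prop :=
  abs_flat R /\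
  forall I : R -> Prop, diff_ideal act I ->
    (forall x, I x -> x = 0) \/ (forall x, I x).

Fixpoint mpoly (R : comNzRingType) (k : nat) : comNzRingType :=
  match k with
  | 0 => R
  | k'.+1 => ({poly mpoly R k'} : comNzRingType)
  end.

Fixpoint mconst (R : comNzRingType) (k : nat) : R -> mpoly R k :=
  match k return R -> mpoly R k with
  | 0 => fun a => a
  | k'.+1 => fun a => (mconst k' a)%:P
  end.

(* the variables X_0, ..., X_{k-1}; X_{k-1} is the outermost indeterminate *)
Fixpoint mvar (R : comNzRingType) (k : nat) : 'I_k -> mpoly R k :=
  match k return 'I_k -> mpoly R k with
  | 0 => fun _ => 0 (* unreachable: 'I_0 is empty *)
  | k'.+1 => fun i => match unlift ord_max i with
                      | Some j => (@mvar R k' j)%:P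
                      | None => 'X
                      end
  end.

Fixpoint meval (R S : comNzRingType) (k : nat) :
    (R -> S) -> ('I_k -> S) -> mpoly R k -> S :=
  match k return (R -> S) -> ('I_k -> S) -> mpoly R k -> S with
  | 0 => fun c _ p => c p
  | k'.+1 => fun c v p =>
      (map_poly (@meval R S k' c (fun i => v (widen_ord (leqnSn k') i))) p)
        .[v ord_max]
  end.

(* indeterminates sigma y_i, indexed by (sigma, i) in gT * 'I_n *)
Definition dvar_index (gT : finGroupType) (n : nat) := (gT * 'I_n)%type.

Definition dpoly (gT : finGroupType) (A : comNzRingType) (n : nat) :
  comNzRingType := mpoly A #|{: dvar_index gT n}|.

Definition dy (gT : finGroupType) (A : comNzRingType) (n : nat)
  (s : gT) (i : 'I_n) : dpoly gT A n :=
  mvar A (enum_rank ((s, i) : dvar_index gT n)).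

Definition dpact (gT : finGroupType) (A : comNzRingType) (act : gT -> A -> A)
  (n : nat) (t : gT) (f : dpoly gT A n) : dpoly gT A n :=
  meval (fun a => mconst _ (act t a))
        (fun j => let: (s, i) := enum_val j in dy A (t * s)%g i) f.

Definition dpeval (gT : finGroupType) (A S : comNzRingType)
  (actS : gT -> S -> S) (c : A -> S) (n : nat) (b : 'I_n -> S)
  (f : dpoly gT A n) : S :=
  meval c (fun j => let: (s, i) := enum_val j in actS s (b i)) f.

Definition dval (gT : finGroupType) (A : comNzRingType) (act : gT -> A -> A)
  (n : nat) (f : dpoly gT A n) (a : 'I_n -> A) : A :=
  dpeval act id a f.

Definition dV (gT : finGroupType) (A : comNzRingType) (act : gT -> A -> A)
  (n : nat) (E : dpoly gT A n -> Prop) : ('I_n -> A) -> Prop :=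
  fun a => forall f, E f -> dval act f a = 0.

Definition dI (gT : finGroupType) (A : comNzRingType) (act : gT -> A -> A)
  (n : nat) (X : ('I_n -> A) -> Prop) : dpoly gT A n -> Prop :=
  fun f => forall a, X a -> dval act f a = 0.

Definition diff_closed (gT : finGroupType) (A : comNzRingType)
  (act : gT -> A -> A) : Prop :=
  pseudofield act /\
  forall (n : nat) (a : dpoly gT A n -> Prop),
    diff_ideal (dpact act (n:=n)) a ->
    forall f, radical a f <-> dI act (dV act a) f.

Definition diff_quotient_of (gT : finGroupType) (A B : comNzRingType)
  (act : gT -> A -> A) (actB : gT -> B -> B) (phi : A -> B) (n : nat) : Prop :=
  exists psi : dpoly gT A n -> B,
    [/\ diff_hom (dpact act (n:=n)) actB psi,
        forall a, psi (mconst _ a) = phi a &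
        forall b, exists f, psi f = b].

Definition diff_fin_gen (gT : finGroupType) (A B : comNzRingType)
  (act : gT -> A -> A) (actB : gT -> B -> B) (phi : A -> B) : Prop :=
  exists n, diff_quotient_of act actB phi n.

Definition diff_gen1 (gT : finGroupType) (A B : comNzRingType)
  (act : gT -> A -> A) (actB : gT -> B -> B) (phi : A -> B) : Prop :=
  diff_quotient_of act actB phi 1.

Definition fun_act (gT : finGroupType) (K : fieldType) (s : gT)
  (f : {ffun gT -> K}) : {ffun gT -> K} := [ffun t => f (s^-1 * t)%g].

(* Main.v *)
Require Import Defs.
From HB Require Import structures.
From mathcomp Require Import all_boot all_order all_algebra all_fingroup.
From mathcomp Require Import all_field boolp classical_sets.
Set Implicit Arguments. Unset Strict Implicit. Unset Printing Implicit Defensive.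
Import GRing.Theory.
Local Open Scope ring_scope.

(** (1) => (2): if B is a quotient of A{y_1,...,y_n} by the difference ideal I,
    then 1 is not in r(I), so V(I) has a point; evaluation there induces a
    difference homomorphism B -> A over A, injective because B has no proper
    difference ideals, hence inverse to A -> B.

    (3) => (4): let pi : A -> K be the residue map of a prime of A (a field, as
    A is absolutely flat). For a simple extension L = K[z] with z <> 0, the map
    a |-> (t |-> pi (t^-1 a)) makes Fun L a pseudofield over A, difference
    generated by the function supported at 1 with value z. Hence A -> Fun L is
    bijective and A -> L is onto. With L = K, z = 1 this gives A = Fun K; with
    arbitrary L it shows that K is algebraically closed.

    (4) => (1): if no power of f lies in the difference ideal I, some prime Q of
    A{y_1,...,y_n} contains I and avoids f. It lies over the prime
    {x | x(s) = 0} of A = Fun K for some s in Sigma, and eliminating the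
    variables one at a time gives a homomorphism chi : A{y_1,...,y_n} -> K
    extending evaluation at s, which kills Q but not f. The functions
    a_i : t |-> chi (s t^-1 y_i) form a point of V(I) at which f does not
    vanish. *)

(** * Prime ideals *)

(** Preservation of 0 and of differences follows by cancellation; bundling the map this way gives
    access to the [rmorph] lemmas. *)
Lemma ring_homP (R S : comNzRingType) (f : R -> S) :
  ring_hom f -> exists F : {rmorphism R -> S}, f = F.
Proof.
case=> fD fM f1.
have f0 : f 0 = 0 by apply: (addrI (f 0)); rewrite -fD !addr0.
have fB : zmod_morphism f.
  move=> x y; apply: (addIr (f y)); rewrite -fD !subrK //.
have fm : monoid_morphism f by split.
pose F : {rmorphism R -> S} := HB.pack_for {rmorphism R -> S} f
  (GRing.isZmodMorphism.Build R S f fB) (GRing.isMonoidMorphism.Build R S f fm).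
by exists F.
Qed.

Lemma rmorph_ring_hom (R S : comNzRingType) (f : {rmorphism R -> S}) :
  ring_hom f.
Proof. by split; [exact: rmorphD | exact: rmorphM | exact: rmorph1]. Qed.

Lemma ring_hom_comp (R S T : comNzRingType) (f : R -> S) (g : S -> T) :
  ring_hom f -> ring_hom g -> ring_hom (g \o f).
Proof.
move=> [fD fM f1] [gD gM g1].
by split=> [x y|x y|] /=; rewrite ?fD ?fM ?f1 ?gD ?gM ?g1.
Qed.

Lemma idealB (R : comNzRingType) (I : R -> Prop) :
  is_ideal I -> forall x y, I x -> I y -> I (x - y).
Proof.
move=> [_ ID IM] x y Ix Iy; apply: ID => //.
by rewrite -mulN1r; apply: IM.
Qed.

Definition prime_ideal (R : comNzRingType) (Q : R -> Prop) : Prop :=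
  [/\ is_ideal Q, ~ Q 1 & forall x y, Q (x * y) -> Q x \/ Q y].

Lemma prime_ideal_exp (R : comNzRingType) (Q : R -> Prop) x k :
  prime_ideal Q -> Q (x ^+ k) -> Q x.
Proof.
move=> [_ Q1 QM]; elim: k => [|k IHk]; first by rewrite expr0 => /Q1.
by rewrite exprS => /QM [].
Qed.

Definition ideal_adjoin (R : comNzRingType) (I : R -> Prop) (x : R) : R -> Prop :=
  fun y => exists u v, I u /\ y = u + v * x.

Lemma ideal_adjoin_ideal (R : comNzRingType) (I : R -> Prop) x :
  is_ideal I -> is_ideal (ideal_adjoin I x).
Proof.
case=> I0 ID IM; split=> [|y z [u [v [Iu ->]]] [u' [v' [Iu' ->]]]|r y [u [v [Iu ->]]]].
- by exists 0, 0; rewrite mul0r addr0.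
- by exists (u + u'), (v + v'); split; [exact: ID | rewrite mulrDl addrACA].
- by exists (r * u), (r * v); split; [exact: IM | rewrite mulrDr mulrA].
Qed.

Lemma sub_ideal_adjoin (R : comNzRingType) (I : R -> Prop) x y :
  I y -> ideal_adjoin I x y.
Proof. by move=> Iy; exists y, 0; rewrite mul0r addr0. Qed.

Lemma mem_ideal_adjoin (R : comNzRingType) (I : R -> Prop) x :
  is_ideal I -> ideal_adjoin I x x.
Proof. by case=> I0 _ _; exists 0, 1; rewrite mul1r add0r. Qed.

(** Zorn's lemma yields an ideal [M] maximal among those that contain [I] and no power of [f]. If
    [x] and [y] lie outside [M], then powers of [f] lie in [M + (x)] and in [M + (y)], and their
    product lies in [M + (xy)]; so [xy] is outside [M]. *)
Lemma prime_ideal_avoiding (R : comNzRingType) (I : R -> Prop) (f : R) :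
  is_ideal I -> ~ radical I f ->
  exists Q, [/\ prime_ideal Q, forall x, I x -> Q x & ~ Q f].
Proof.
move=> idI radIf.
pose good (X : set R) :=
  [/\ is_ideal X, forall x, I x -> X x & ~ radical X f].
(* The guard admits the empty set, which is the union of the empty chain. *)
pose P (X : set R) := (exists x, X x) -> good X.
have goodI : good I by split.
have [F FP Ftot|M [PM Mmax]] := @Zorn_bigcup R P.
  move=> [x0 [X0 FX0 X0x0]].
  have gF X x : F X -> X x -> good X by move=> /FP PX Xx; apply: PX; exists x.
  have [[X00 _ _] IX0 _] := gF _ _ FX0 X0x0.
  split.
  - split; first by exists X0.
    + move=> x y [X FX Xx] [Y FY Yy].
      have [XY|YX] := Ftot X Y FX FY.
        exists Y => //; have [[_ YD _] _ _] := gF _ _ FY Yy.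
        by apply: YD => //; apply: XY.
      exists X => //; have [[_ XD _] _ _] := gF _ _ FX Xx.
      by apply: XD => //; apply: YX.
    + move=> r x [X FX Xx]; exists X => //.
      by have [[_ _ XM] _ _] := gF _ _ FX Xx; apply: XM.
  - by move=> x Ix; exists X0 => //; apply: IX0.
  - move=> [k [X FX Xfk]].
    by have [_ _ radX] := gF _ _ FX Xfk; apply: radX; exists k.
(* The maximal set is not empty, for [I] would be a strictly larger admissible set. *)
have [idM IM radMf] : good M.
  apply: PM; apply: contrapT => M0; apply: (Mmax I) => //; split=> [x Mx|IM].
    by case: M0; exists x.
  by apply: M0; exists 0; apply: IM; case: idI.
have adjM x : ~ M x -> radical (ideal_adjoin M x) f.
  move=> Mx; apply: contrapT => radMx.
  apply: (Mmax (ideal_adjoin M x)); last first.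
    split=> //; first exact: ideal_adjoin_ideal.
    by move=> y /IM; apply: sub_ideal_adjoin.
  split=> [y My|sub]; first exact: sub_ideal_adjoin.
  by apply: Mx; apply: sub; apply: mem_ideal_adjoin.
exists M; split=> //; last by move=> Mf; apply: radMf; exists 1%N.
case: (idM) => M0 MD MM; split=> // [M1|x y Mxy].
  by apply: radMf; exists 0%N.
apply: contrapT => /not_orP [/adjM [k [u [v [Mu fk]]]]].
move=> /adjM [l [u' [v' [Mu' fl]]]].
apply: radMf; exists (k + l)%N; rewrite exprD fk fl mulrDl !mulrDr addrA.
apply: (MD); last by rewrite mulrACA; apply: MM.
apply: (MD); last exact: MM.
by apply: (MD); [exact: MM | rewrite mulrC; exact: MM].
Qed.

(** * Extending homomorphisms to a polynomial ring modulo a prime *)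

Lemma ideal_poly (R : comNzRingType) (Q : {poly R} -> Prop) (p : {poly R}) :
  is_ideal Q -> (forall i, Q (p`_i)%:P) -> Q p.
Proof.
move=> [Q0 QD QM] Qp; rewrite -[p]coefK poly_def.
by apply: (big_ind Q) => // i _; rewrite -mul_polyC mulrC; apply: QM.
Qed.

(** Take [h] of least size among the elements of [J] with a coefficient outside [Q]. If its leading
    coefficient lay in [Q], removing the leading term would leave a smaller such element. *)
Lemma minimal_degree_mod (R : comNzRingType) (Q J : {poly R} -> Prop) :
  is_ideal Q -> is_ideal J -> (forall p, Q p -> J p) ->
  (exists h, J h /\ exists i, ~ Q (h`_i)%:P) ->
  exists h, [/\ J h, ~ Q (lead_coef h)%:P &
    forall r, J r -> (size r < size h)%N -> forall i, Q (r`_i)%:P].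
Proof.
move=> idQ idJ QJ [h0 [Jh0 [i0 Qh0]]].
have [Q0 QD QM] := idQ.
pose bad n := `[< exists h, [/\ J h, size h = n & exists i, ~ Q (h`_i)%:P] >].
have ex_bad : exists n, bad n.
  by exists (size h0); apply/asboolP; exists h0; split=> //; exists i0.
have [n /asboolP [h [Jh sz_h [i Qhi]]] n_min] := ex_minnP ex_bad.
have small r : J r -> (size r < n)%N -> forall j, Q (r`_j)%:P.
  move=> Jr lt_r j; apply: contrapT => Qrj; move: lt_r; rewrite ltnNge.
  by apply/negP/negPn/n_min/asboolP; exists r; split=> //; exists j.
exists h; rewrite sz_h; split=> // Ql; apply: Qhi.
case: n sz_h {n_min} small => [/eqP|m] sz_h small.
  by rewrite size_poly_eq0 in sz_h; rewrite (eqP sz_h) coef0 polyC0.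
have lead_h : lead_coef h = h`_m by rewrite /lead_coef sz_h.
have Jtop : J (lead_coef h *: 'X^m).
  by apply: QJ; rewrite -mul_polyC mulrC; apply: QM.
have [->|neq_im] := eqVneq i m; first by rewrite -lead_h.
have -> : h`_i = (h - lead_coef h *: 'X^m)`_i.
  by rewrite coefB coefZ coefXn (negPf neq_im) mulr0 subr0.
apply: small; first exact: idealB.
rewrite ltnS; apply/leq_sizeP => j le_mj.
rewrite coefB coefZ coefXn; have [->|neq_jm] := eqVneq j m.
  by rewrite mulr1 lead_h subrr.
rewrite mulr0 subr0 nth_default // sz_h.
by rewrite ltn_neqAle eq_sym neq_jm.
Qed.

Lemma coefM_top (R : comNzRingType) (p w : {poly R}) m n :
  (size p <= m.+1)%N -> (size w <= n.+1)%N -> (p * w)`_(m + n) = p`_m * w`_n.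
Proof.
move=> le_p le_w; have lt_m : (m < (m + n).+1)%N by rewrite ltnS leq_addr.
rewrite coefM (bigD1 (Ordinal lt_m)) //= addKn big1 ?addr0 // => j neq_jm.
have [lt_jm|lt_mj|eq_jm] := ltngtP j m; last by case/eqP: neq_jm; apply/val_inj.
- by rewrite [w`__]nth_default ?mulr0 // (leq_trans le_w) // ltn_subRL ltn_add2r.
- by rewrite nth_default ?mul0r // (leq_trans le_p).
Qed.

(** A nonzero polynomial over the domain [R/q] is not a zero divisor. The quotient is never formed:
    the top coefficient of [w] is shown to lie in [q] and is stripped off, by induction on the
    size. *)
Lemma ideal_coef_cancel (R : comNzRingType) (q : R -> Prop) (p w : {poly R}) :
  is_ideal q -> (forall x y, q (x * y) -> q x \/ q y) -> ~ q (lead_coef p) ->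
  (forall i, q (p * w)`_i) -> forall i, q w`_i.
Proof.
move=> idq qM qp; have [q0 qD qMl] := idq.
have [n] := ubnP (size w); elim: n w => // n IHn w lt_w qpw.
have [->|w_neq0] := eqVneq w 0; first by move=> i; rewrite coef0.
have w_gt0 : (0 < size w)%N by rewrite size_poly_gt0.
set m := (size w).-1.
have qw : q w`_m.
  case: (qM (lead_coef p) w`_m) => //.
  by rewrite /lead_coef -coefM_top ?leqSpred //; apply: qpw.
pose w1 := w - w`_m *: 'X^m; have small_w : (size w1 < n)%N.
  apply: leq_trans (lt_w : (size w <= n)%N); rewrite -(ltn_predK w_gt0) -/m ltnS.
  apply/leq_sizeP => j le_mj; rewrite coefB coefZ coefXn.
  have [->|neq_jm] := eqVneq j m; first by rewrite mulr1 subrr.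
  rewrite mulr0 subr0 nth_default // -(ltn_predK w_gt0) -/m.
  by rewrite ltn_neqAle eq_sym neq_jm.
move=> i; rewrite -[w](subrK (w`_m *: 'X^m)) coefD; apply: (qD).
  apply: (IHn w1) => // j; rewrite mulrBr coefB; apply: idealB => //.
  by rewrite -scalerAr coefZ mulrC; apply: (qMl).
by rewrite coefZ mulrC; apply: (qMl).
Qed.

Lemma prime_contraction (R : comNzRingType) (Q : {poly R} -> Prop) :
  prime_ideal Q -> prime_ideal (fun r => Q r%:P).
Proof.
move=> [[Q0 QD QM] Q1 Qmul]; split=> [|//|x y]; last by rewrite polyCM; apply: Qmul.
split=> // [x y|r x]; first by rewrite polyCD; apply: QD.
by rewrite polyCM; apply: QM.
Qed.

(* If all coefficients of elements of [Q] contract into [Q], any point avoiding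
   the roots of [f] works. Otherwise, modulo [q] = [Q] inter [R], [Q] is
   generated up to denominators by an element [p] of minimal degree; the ideal
   [Q + (f)] contains a constant [c] outside [q], and [chi] extends to any root
   of [p] as soon as [c] and the leading coefficient of [p] do not vanish. *)
Lemma prime_poly_extension (R : comNzRingType) (Q : {poly R} -> Prop)
    (f : {poly R}) :
  prime_ideal Q -> ~ Q f ->
  exists2 g : R, ~ Q g%:P &
    forall (K : closedFieldType) (chi : {rmorphism R -> K}),
      (forall r, Q r%:P -> chi r = 0) -> chi g != 0 ->
      exists c, (forall p, Q p -> (map_poly chi p).[c] = 0) /\
                (map_poly chi f).[c] != 0.
Proof.
move=> primeQ Qf; have [idQ Q1 Qmul] := primeQ; have [Q0 QD QM] := idQ.
pose q r := Q r%:P; have [idq q1 qmul] := prime_contraction primeQ.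
have map0 (K : closedFieldType) (chi : {rmorphism R -> K}) (p : {poly R}) :
    (forall r, Q r%:P -> chi r = 0) -> (forall i, q p`_i) -> map_poly chi p = 0.
  by move=> chiQ qp; apply/polyP => i; rewrite coef_map coef0; apply: chiQ; apply: qp.
have [[p0 [Qp0 qp0]]|allq] :=
    pselect (exists p, Q p /\ exists i, ~ q p`_i); last first.
  have [i qfi] : exists i, ~ q f`_i.
    apply/existsNP => qf; apply: Qf; exact: (ideal_poly idQ).
  exists f`_i => // K chi chiQ chifi.
  have : map_poly chi f != 0.
    by apply: contraNneq chifi => f0; rewrite -coef_map f0 coef0.
  move=> /closed_nonrootP [c fc]; exists c; split=> // p Qp.
  rewrite (map0 _ _ p chiQ) ?horner0 // => j; apply: contrapT => qpj.
  by apply: allq; exists p; split=> //; exists j.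
(* Over the fraction field of [R/q], [p] generates the extension of [Q], and [h] below that of
   [Q + (f)]. *)
have [p [Qp qp minp]] := minimal_degree_mod idQ idQ (fun _ => id)
  (ex_intro _ p0 (conj Qp0 qp0)).
pose J := ideal_adjoin Q f.
have idJ : is_ideal J := ideal_adjoin_ideal f idQ.
have QJ x : Q x -> J x by apply: sub_ideal_adjoin.
have [h [Jh qh minh]] := minimal_degree_mod idQ idJ QJ
  (ex_intro _ p0 (conj (QJ _ Qp0) qp0)).
have lead_neq0 (w : {poly R}) : ~ q (lead_coef w) -> w != 0.
  by move=> qw; apply/eqP => w0; apply: qw; rewrite w0 lead_coef0 /q polyC0.
pose Div := Pdiv.ComRing.rdivp_eq.
have expQ w k : ~ q w -> ~ q (w ^+ k).
  move=> qw qwk; apply: qw.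
  exact: (prime_ideal_exp (prime_contraction primeQ) qwk).
have QZ w (x : {poly R}) : Q x -> Q (w *: x) by rewrite -mul_polyC; apply: QM.
have rem_small w (x : {poly R}) : w != 0 -> J w -> J x -> J (Pdiv.Ring.rmodp x w).
  move=> w_neq0 Jw Jx; have [_ _ JM] := idJ.
  have -> : Pdiv.Ring.rmodp x w = lead_coef w ^+ Pdiv.Ring.rscalp x w *: x
             - Pdiv.Ring.rdivp x w * w by rewrite Div [RHS]addrC addKr.
  by apply: idealB => //; [rewrite -mul_polyC|]; apply: JM.
have rem_h x : J x -> forall i, q (Pdiv.Ring.rmodp x h)`_i.
  move=> Jx; have h_neq0 := lead_neq0 _ qh.
  by apply: minh; [exact: rem_small | rewrite Pdiv.Ring.ltn_rmodp].
(* Otherwise pseudo-division of [f] by [h] puts a power of [lead_coef h] times [f] into the prime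
   [Q]. *)
have Qh : ~ Q h.
  move=> Qh; have Jf : J f by apply: mem_ideal_adjoin.
  have : Q ((lead_coef h ^+ Pdiv.Ring.rscalp f h)%:P * f).
    rewrite mul_polyC Div; apply: (QD); first exact: QM.
    by apply: (ideal_poly idQ); apply: rem_h.
  by move=> /Qmul [|//]; apply: expQ.
(* The remainder of [p] by [h] vanishes modulo [q], so [s * h] lies in [Q], and hence so does [s].
   Dividing [s] back by [p] then also leaves a remainder that vanishes modulo [q]. *)
set k := Pdiv.Ring.rscalp p h; set s := Pdiv.Ring.rdivp p h.
set r := Pdiv.Ring.rmodp p h.
have eq_p : lead_coef h ^+ k *: p = s * h + r := Div _ _ _.
have qr : forall i, q r`_i by apply: rem_h; apply: QJ.
have Qs : Q s.
  have : Q (s * h).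
    rewrite -[s * h](addrK r) -eq_p; apply: idealB => //; first exact: QZ.
    exact: (ideal_poly idQ).
  by move=> /Qmul [].
set m := Pdiv.Ring.rscalp s p; set t := Pdiv.Ring.rdivp s p.
set r2 := Pdiv.Ring.rmodp s p.
have eq_s : lead_coef p ^+ m *: s = t * p + r2 := Div _ _ _.
have qr2 : forall i, q r2`_i.
  apply: minp; last by rewrite Pdiv.Ring.ltn_rmodp lead_neq0.
  have -> : r2 = lead_coef p ^+ m *: s - t * p by rewrite eq_s addrC addKr.
  by apply: idealB => //; [exact: QZ | exact: QM].
(* [c - t h] is congruent to 0 modulo [q], since its product with [p] is. *)
pose c := lead_coef p ^+ m * lead_coef h ^+ k.
have Qc : ~ q c by move=> /qmul [] /expQ; apply.
have Jc : J c%:P.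
  have [J0 JD JM] := idJ; rewrite -[c%:P](subrK (t * h)).
  apply: JD; last exact: JM.
  apply: QJ; apply: (ideal_poly idQ); rewrite -/q.
  apply: (@ideal_coef_cancel _ q p _ idq qmul qp) => i.
  have -> : p * (c%:P - t * h) = h * r2 + lead_coef p ^+ m *: r.
    rewrite mulrBr [p * c%:P]mulrC mul_polyC -scalerA eq_p scalerDr.
    rewrite scalerAl eq_s mulrDl [t * p]mulrC -!mulrA [r2 * h]mulrC.
    by rewrite addrC !addrA addNr add0r.
  have [q0 qD qM] := idq; rewrite coefD coefZ; apply: (qD); last exact: (qM _ _ (qr i)).
  by rewrite coefM; apply: (big_ind q) => // j _; apply: (qM _ _ (qr2 _)).
have [u [v [Qu eq_c]]] := Jc.
(* The factor [lead_coef p] preserves the degree of [p] under [chi]; the factor [c] excludes a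
   common zero of [u] and [f]. *)
exists (lead_coef p * c); first by move=> /qmul [].
move=> K chi chiQ; rewrite rmorphM mulf_eq0 negb_or => /andP [chip chic].
have sz_p : size (map_poly chi p) = size p by rewrite size_map_poly_id0.
have p_gt1 : (1 < size p)%N.
  rewrite ltnNge; apply/negP => /size1_polyC eqp.
  by apply: qp; rewrite eqp lead_coefC -eqp.
have /closed_rootP [z /rootP pz] : size (map_poly chi p) != 1%N.
  by rewrite sz_p neq_ltn p_gt1 orbT.
have kill (w : {poly R}) : Q w -> (map_poly chi w).[z] = 0.
  move=> Qw; have := Div _ p w.
  set rw := Pdiv.Ring.rmodp w p => eqw.
  have qrw : forall i, q rw`_i.
    apply: minp; last by rewrite Pdiv.Ring.ltn_rmodp lead_neq0.
    rewrite (_ : rw = lead_coef p ^+ Pdiv.Ring.rscalp w p *: w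
                      - Pdiv.Ring.rdivp w p * p); last by rewrite eqw addrC addKr.
    by apply: idealB => //; [exact: QZ | exact: QM].
  have /eqP := congr1 (fun x : {poly R} => (map_poly chi x).[z]) eqw.
  rewrite /= rmorphD rmorphM /= hornerD hornerM pz mulr0 add0r (map0 _ _ rw) //.
  rewrite horner0 -mul_polyC rmorphM /= map_polyC hornerM hornerC mulf_eq0.
  by rewrite /= rmorphXn expf_eq0 (negPf chip) andbF => /eqP.
exists z; split=> //; apply: contraNneq chic => fz.
have := congr1 (fun x : {poly R} => (map_poly chi x).[z]) eq_c.
rewrite /= map_polyC hornerC rmorphD rmorphM /= hornerD hornerM fz mulr0 addr0.
by move=> ->; rewrite kill.
Qed.

(** * Difference polynomials *)

Lemma mconst_ring_hom (R : comNzRingType) k : ring_hom (@mconst R k).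
Proof.
elim: k => [|k IHk] //=.
exact: (ring_hom_comp IHk (rmorph_ring_hom polyC)).
Qed.

Lemma meval_ring_hom (R S : comNzRingType) k (c : R -> S) (v : 'I_k -> S) :
  ring_hom c -> ring_hom (meval c v).
Proof.
move=> hc; elim: k v => [|k IHk] v //=.
have [F eqF] := ring_homP (IHk (fun i => v (widen_ord (leqnSn k) i))).
rewrite eqF; split=> [x y|x y|].
- by rewrite rmorphD hornerD.
- by rewrite rmorphM hornerM.
- by rewrite rmorph1 hornerC.
Qed.

Lemma mevalS (R S : comNzRingType) k (c : R -> S) (v : 'I_k.+1 -> S)
    (p : mpoly R k.+1) :
  meval c v p =
  (map_poly (meval c (fun i => v (widen_ord (leqnSn k) i))) p).[v ord_max].
Proof. by []. Qed.

Lemma mevalC (R S : comNzRingType) k (c : R -> S) (v : 'I_k -> S) a :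
  ring_hom c -> meval c v (mconst k a) = c a.
Proof.
move=> hc; elim: k v => [|k IHk] v //=.
have [F eqF] := ring_homP (meval_ring_hom (fun i => v (widen_ord (leqnSn k) i)) hc).
by rewrite eqF map_polyC hornerC /= -eqF IHk.
Qed.

Lemma mevalX (R S : comNzRingType) k (c : R -> S) (v : 'I_k -> S) i :
  ring_hom c -> meval c v (mvar R i) = v i.
Proof.
move=> hc; elim: k v i => [|k IHk] v i; first by case: i.
have [F eqF] := ring_homP (meval_ring_hom (fun i => v (widen_ord (leqnSn k) i)) hc).
rewrite mevalS /= eqF; case: unliftP => [j|] ->.
  rewrite map_polyC hornerC /= -eqF IHk; congr v; apply/val_inj => /=.
  by rewrite /bump leqNgt ltn_ord.
by rewrite map_polyX hornerX.
Qed.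

Lemma mpoly_hom_ext (R S : comNzRingType) k (F G : mpoly R k -> S) :
  ring_hom F -> ring_hom G -> (forall a, F (mconst k a) = G (mconst k a)) ->
  (forall i, F (mvar R i) = G (mvar R i)) -> F =1 G.
Proof.
elim: k F G => [|k IHk] F G hF hG eqC eqX; first exact: eqC.
have eqP : (F \o polyC) =1 (G \o polyC).
  apply: IHk.
  - exact: ring_hom_comp (rmorph_ring_hom polyC) hF.
  - exact: ring_hom_comp (rmorph_ring_hom polyC) hG.
  - exact: eqC.
  - move=> j; have := eqX (lift ord_max j).
    by rewrite /= liftK.
have := eqX ord_max; rewrite /= unlift_none => eqXk.
have [F' eF] := ring_homP hF; have [G' eG] := ring_homP hG.
move=> p; rewrite -[p]coefK poly_def eF eG !rmorph_sum.
apply: eq_bigr => i _; rewrite -mul_polyC !rmorphM !rmorphXn -eF -eG eqXk.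
by congr (_ * _); apply: eqP.
Qed.

Lemma dpoly_hom_ext (gT : finGroupType) (A S : comNzRingType) n
    (F G : dpoly gT A n -> S) :
  ring_hom F -> ring_hom G -> (forall a, F (mconst _ a) = G (mconst _ a)) ->
  (forall s i, F (dy A s i) = G (dy A s i)) -> F =1 G.
Proof.
move=> hF hG eqC eqX; apply: mpoly_hom_ext => // j.
by have := eqX (enum_val j).1 (enum_val j).2; rewrite /dy -surjective_pairing enum_valK.
Qed.

Lemma dpeval_ring_hom (gT : finGroupType) (A S : comNzRingType)
    (actS : gT -> S -> S) (c : A -> S) n (b : 'I_n -> S) :
  ring_hom c -> ring_hom (dpeval actS c b).
Proof. exact: meval_ring_hom. Qed.

Lemma dpevalC (gT : finGroupType) (A S : comNzRingType)
    (actS : gT -> S -> S) (c : A -> S) n (b : 'I_n -> S) a :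
  ring_hom c -> dpeval actS c b (mconst _ a) = c a.
Proof. exact: mevalC. Qed.

Lemma dpevalX (gT : finGroupType) (A S : comNzRingType)
    (actS : gT -> S -> S) (c : A -> S) n (b : 'I_n -> S) s i :
  ring_hom c -> dpeval actS c b (dy A s i) = actS s (b i).
Proof. by move=> hc; rewrite /dpeval mevalX // enum_rankK. Qed.

Section DifferencePolynomialAction.
Variables (gT : finGroupType) (A : comNzRingType) (act : gT -> A -> A).
Hypothesis Hact : diff_action act.
Variable n : nat.

Let mconst_act_ring_hom t :
  ring_hom (fun a => mconst #|{: dvar_index gT n}| (act t a)).
Proof.
have [hact _ _] := Hact.
exact: ring_hom_comp (hact t) (@mconst_ring_hom A _).
Qed.

Lemma dpact_ring_hom t : ring_hom (dpact act (n:=n) t).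
Proof. exact: meval_ring_hom. Qed.

Lemma dpactC t a : dpact act t (mconst _ a) = mconst _ (act t a) :> dpoly gT A n.
Proof. by rewrite /dpact mevalC. Qed.

Lemma dpactX t s i : dpact act t (dy A s i) = dy A (t * s)%g i :> dpoly gT A n.
Proof. by rewrite /dpact mevalX // enum_rankK. Qed.

Lemma dpact1 : dpact act (n:=n) 1%g =1 id.
Proof.
have [_ act1 _] := Hact.
apply: dpoly_hom_ext (dpact_ring_hom 1) _ _ _ => [|a|s i].
- exact: (rmorph_ring_hom idfun).
- by rewrite dpactC act1.
- by rewrite dpactX mul1g.
Qed.

Lemma dpeval_dpact (S : comNzRingType) (actS : gT -> S -> S) (c : A -> S)
    (b : 'I_n -> S) t f :
  diff_action actS -> diff_hom act actS c ->
  dpeval actS c b (dpact act t f) = actS t (dpeval actS c b f).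
Proof.
move=> [hactS _ actSM] [hc c_act]; have hev := dpeval_ring_hom actS b hc.
apply: (dpoly_hom_ext (F := dpeval actS c b \o dpact act t)
  (G := actS t \o dpeval actS c b)) => [||a|s i] /=.
- exact: ring_hom_comp (dpact_ring_hom t) hev.
- exact: ring_hom_comp hev (hactS t).
- by rewrite dpactC !dpevalC // c_act.
- by rewrite dpactX !dpevalX // actSM.
Qed.

End DifferencePolynomialAction.

Lemma dval_ring_hom (gT : finGroupType) (A : comNzRingType)
    (act : gT -> A -> A) n (a : 'I_n -> A) :
  ring_hom (fun f : dpoly gT A n => dval act f a).
Proof. exact/dpeval_ring_hom/(rmorph_ring_hom idfun). Qed.

(** Each use of [prime_poly_extension] eliminates the outermost indeterminate and trades [f] for a
    polynomial in the remaining ones, down to a constant [g]. The coordinates of [c] are then chosen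
    in the reverse order. *)
Lemma prime_mpoly_extension (A : comNzRingType) k (Q : mpoly A k -> Prop)
    (f : mpoly A k) :
  prime_ideal Q -> ~ Q f ->
  exists2 g : A, ~ Q (mconst k g) &
    forall (K : closedFieldType) (chi : A -> K), ring_hom chi ->
      (forall r, Q (mconst k r) -> chi r = 0) -> chi g != 0 ->
      exists c : 'I_k -> K,
        (forall p, Q p -> meval chi c p = 0) /\ meval chi c f != 0.
Proof.
elim: k Q f => [|k IHk] Q f primeQ Qf.
  by exists f => // K chi hchi chiQ chif; exists (fun _ => 0).
have [g1 Qg1 ext1] := prime_poly_extension primeQ Qf.
have [g Qg ext] := IHk _ _ (prime_contraction primeQ) Qg1.
exists g => // K chi hchi chiQ chig.
have [c [cQ cg1]] := ext K chi hchi chiQ chig.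
have [F eF] := ring_homP (meval_ring_hom c hchi).
rewrite eF in cQ cg1; have [z [zQ zf]] := ext1 K F cQ cg1.
pose c' i := if unlift ord_max i is Some j then c j else z.
have c'E p : meval chi c' p = (map_poly F p).[z].
  rewrite mevalS {2}/c' unlift_none; congr (_.[z]).
  rewrite -eF; congr (map_poly (meval chi _) p); apply/funext => i.
  rewrite /c' (_ : widen_ord _ i = lift ord_max i) ?liftK //.
  by apply/val_inj; rewrite /= /bump leqNgt ltn_ord.
by exists c'; split=> [p Qp|]; rewrite c'E //; apply: zQ.
Qed.

(** * Nullstellensatz over Fun K *)

Lemma kernel_diff_ideal (gT : finGroupType) (R S : comNzRingType)
    (actR : gT -> R -> R) (actS : gT -> S -> S) (f : R -> S) :
  diff_action actS -> diff_hom actR actS f -> diff_ideal actR (fun x => f x = 0).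
Proof.
move=> [hactS _ _] [hf f_act]; have [F eF] := ring_homP hf; rewrite eF in f_act *.
split=> [|g x Fx0]; last first.
  by have [G eG] := ring_homP (hactS g); rewrite f_act Fx0 eG rmorph0.
split=> [|x y Fx0 Fy0|r x Fx0]; first exact: rmorph0.
  by rewrite rmorphD Fx0 Fy0 addr0.
by rewrite rmorphM Fx0 mulr0.
Qed.

(** The kernel is a difference ideal that does not contain 1. *)
Lemma pseudofield_hom_inj (gT : finGroupType) (R S : comNzRingType)
    (actR : gT -> R -> R) (actS : gT -> S -> S) (f : R -> S) :
  pseudofield actR -> diff_action actS -> diff_hom actR actS f -> injective f.
Proof.
move=> [_ simpleR] HactS hf.
have [F eF] := ring_homP (proj1 hf).
case: (simpleR _ (kernel_diff_ideal HactS hf)) => ker_f; last first.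
  by have /eqP := ker_f 1; rewrite eF rmorph1 oner_eq0.
move=> x y eq_fxy; apply/eqP; rewrite -subr_eq0; apply/eqP/ker_f.
by move: eq_fxy; rewrite eF rmorphB => ->; rewrite subrr.
Qed.

Lemma diff_closed_fin_gen_bij (gT : finGroupType) (A B : comNzRingType)
    (act : gT -> A -> A) (actB : gT -> B -> B) (phi : A -> B) :
  diff_action act -> diff_closed act -> diff_action actB ->
  diff_hom act actB phi -> pseudofield actB -> diff_fin_gen act actB phi ->
  bijective phi.
Proof.
move=> Hact [HA nullA] HactB Hphi HB [n [psi [Hpsi psiC psi_surj]]].
pose I (f : dpoly gT A n) := psi f = 0.
have idI : diff_ideal (dpact act (n:=n)) I := kernel_diff_ideal HactB Hpsi.
have [Psi ePsi] := ring_homP (proj1 Hpsi).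
(* If there were no zeros, 1 would vanish on all of them and so lie in the radical of [I]. *)
have [a Va] : exists a, dV act I a.
  apply: contrapT => /forallNP noV.
  have [k] : radical I (1 : dpoly gT A n).
    by apply/nullA => // a Va; case: (noV a).
  by rewrite expr1n /I ePsi rmorph1 => /eqP; rewrite oner_eq0.
have [Ev eEv] := ring_homP (dval_ring_hom act a).
have EvE f : dval act f a = Ev f by rewrite -eEv.
(* The choice of preimage is immaterial: [a] is a zero of [I], so [Ev] kills the kernel of [psi]. *)
pose e b := Ev (projT1 (cid (psi_surj b))).
have e_psi f : e (psi f) = Ev f.
  rewrite /e; case: cid => /= f' eq_f'; apply/eqP; rewrite -subr_eq0 -rmorphB -EvE.
  by apply/eqP/Va; rewrite /I ePsi rmorphB -ePsi eq_f' subrr.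
have he : ring_hom e.
  split.
  - move=> x y; have [f <-] := psi_surj x; have [g <-] := psi_surj y.
    by rewrite ePsi -rmorphD -ePsi !e_psi rmorphD.
  - move=> x y; have [f <-] := psi_surj x; have [g <-] := psi_surj y.
    by rewrite ePsi -rmorphM -ePsi !e_psi rmorphM.
  - by rewrite -(rmorph1 Psi) -ePsi e_psi rmorph1.
have hid : diff_hom act act (id : A -> A) by split=> //; apply: (rmorph_ring_hom idfun).
have e_hom : diff_hom actB act e.
  split=> // g b; have [f <-] := psi_surj b; have [_ psi_act] := Hpsi.
  by rewrite -psi_act !e_psi -!EvE /dval (dpeval_dpact Hact).
have e_inj := pseudofield_hom_inj HB Hact e_hom.
have e_phi x : e (phi x) = x.
  rewrite -psiC e_psi -EvE /dval dpevalC //; exact: (rmorph_ring_hom idfun).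
by exists e => // b; apply: e_inj; rewrite e_phi.
Qed.

Definition fun_iso (gT : finGroupType) (A : comNzRingType) (act : gT -> A -> A)
    (K : fieldType) (iso : A -> {ffun gT -> K}) : Prop :=
  [/\ bijective iso,
      forall x y t, iso (x + y) t = iso x t + iso y t,
      forall x y t, iso (x * y) t = iso x t * iso y t,
      forall t, iso 1 t = 1 &
      forall s x, iso (act s x) = fun_act s (iso x)].

Lemma fun_iso_diff_closed (gT : finGroupType) (A : comNzRingType)
    (act : gT -> A -> A) (K : closedFieldType) (iso : A -> {ffun gT -> K}) :
  diff_action act -> pseudofield act -> fun_iso act iso -> diff_closed act.
Proof.
move=> Hact HA [[osi isoK osiK] isoD isoM iso1 iso_act]; split=> // n a [id_a a_act] f.
pose ev (s : gT) (x : A) : K := iso x s.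
have hev s : ring_hom (ev s) by split=> [x y|x y|]; rewrite /ev ?isoD ?isoM ?iso1.
have ev0 s : ev s 0 = 0 by have [F ->] := ring_homP (hev s); apply: rmorph0.
have iso0 x : (forall s, ev s x = 0) -> x = 0.
  by move=> x0; apply: (can_inj isoK); apply/ffunP => s; rewrite -!/(ev s _) x0 ev0.
split=> [[k afk] z Vz|If].
  have [F eF] := ring_homP (dval_ring_hom act z).
  have eFE p : dval act p z = F p by rewrite -eF.
  (* Each coordinate of the value of [f] has a zero power in the field [K]. *)
  apply: iso0 => s; have [G eG] := ring_homP (hev s); apply/eqP.
  have /eqP := Vz _ afk; rewrite eFE rmorphXn => /eqP Fk0.
  have := congr1 G Fk0; rewrite rmorphXn rmorph0 eG -eFE => /eqP.
  by rewrite expf_eq0 => /andP [].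
apply: contrapT => /(prime_ideal_avoiding id_a) [Q [primeQ aQ Qf]].
have [g Qg ext] := prime_mpoly_extension primeQ Qf.
pose q x := Q (mconst _ x).
have primeq : prime_ideal q.
  have [C eC] := ring_homP (@mconst_ring_hom A #|{: dvar_index gT n}|).
  have [[Q0 QD QM] Q1 Qmul] := primeQ; rewrite /q eC.
  split=> [||x y]; last by rewrite rmorphM; apply: Qmul.
    split=> [|x y|r x]; first by rewrite rmorph0.
      by rewrite rmorphD; apply: QD.
    by rewrite rmorphM; apply: QM.
  by rewrite rmorph1.
have [[q0 qD qM] q1 qmul] := primeq.
(* These idempotents sum to 1, so at least one of them lies outside [q]. *)
pose e s := osi [ffun t => (t == s)%:R].
have e_ev s t : ev t (e s) = (t == s)%:R by rewrite /ev /e osiK ffunE.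
have [s qs] : exists s, ~ q (e s).
  apply/existsNP => qe; apply: q1.
  rewrite (_ : 1 = \sum_s e s); first by apply: (big_ind q) => // s _; apply: contrapT.
  apply: (can_inj isoK); apply/ffunP => t; rewrite -!/(ev t _) {1}/ev iso1.
  have [F eF] := ring_homP (hev t); rewrite eF rmorph_sum (bigD1 t) //= -eF e_ev eqxx.
  by rewrite big1 ?addr0 // => s /negPf neq_st; rewrite e_ev eq_sym neq_st.
(* If [x] vanishes at [s], then [x * e s = 0] lies in the prime [q]; otherwise [e s] is a multiple
   of [x]. *)
have q_ev x : q x <-> ev s x = 0.
  split=> [qx|x0]; last first.
    have : q (x * e s).
      rewrite (_ : x * e s = 0) //; apply: iso0 => t.
      have [_ evM _] := hev t; rewrite evM e_ev; case: eqP => [->|_].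
        by rewrite x0 mul0r.
      by rewrite mulr0.
    by move=> /qmul [].
  apply: contrapT => /eqP x0; apply: qs.
  have -> : e s = osi [ffun t => (t == s)%:R / ev s x] * x.
    apply: (can_inj isoK); apply/ffunP => t; rewrite isoM -/(ev t x) !osiK !ffunE.
    by case: eqP => [->|_]; rewrite ?divfK // !mul0r.
  exact: qM.
have [c [cQ cf]] := ext K (ev s) (hev s) (fun x => (q_ev x).1)
  (introN eqP (fun gs => Qg ((q_ev g).2 gs))).
pose chi := meval (ev s) c.
have hchi : ring_hom chi := meval_ring_hom c (hev s).
(* This makes the value at [t] of substituting [z] equal to [chi] after translation by [s * t^-1].
   On constants this holds because translating [x] by [s * t^-1] moves its value at [t] to [s]. At
   [t = s] one recovers [chi] itself. *)
pose z i := osi [ffun t => chi (dy A (s * t^-1)%g i)].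
have val_z p t : ev t (dval act p z) = chi (dpact act (s * t^-1)%g p).
  apply: (dpoly_hom_ext (F := ev t \o (fun p => dval act p z))
    (G := chi \o dpact act (s * t^-1)%g)) => [||x|r i] /=.
  - exact: ring_hom_comp (dval_ring_hom act z) (hev t).
  - exact: ring_hom_comp (dpact_ring_hom Hact _ _) hchi.
  - rewrite dpactC // /dval dpevalC; last exact: (rmorph_ring_hom idfun).
    rewrite /chi mevalC // /ev iso_act ffunE; congr (iso x _).
    by rewrite invMg invgK mulgKV.
  - rewrite dpactX // /dval dpevalX; last exact: (rmorph_ring_hom idfun).
    by rewrite /ev iso_act ffunE osiK ffunE invMg invgK mulgA.
have Vz : dV act a z.
  by move=> p ap; apply: iso0 => t; rewrite val_z; apply/cQ/aQ/a_act.
have := val_z f s; rewrite mulgV dpact1 // (If _ Vz) ev0 => chif.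
by rewrite -/chi -chif eqxx in cf.
Qed.

(** * Functions into a residue field *)

(** From [a = a * a * b] one gets [a * (1 - b * a) = 0], so modulo the prime [Q] either [a] is zero
    or [b] is its inverse. *)
Lemma abs_flat_residue_field (A : comNzRingType) (Q : A -> Prop) :
  abs_flat A -> prime_ideal Q ->
  exists (K : fieldType) (pi : {rmorphism A -> K}), forall u, exists a, u = pi a.
Proof.
move=> flatA [[Q0 QD QM] Q1 Qmul].
pose S : {pred A} := fun x => `[< Q x >].
have S_ideal : idealr_closed S.
  split; first exact/asboolP.
    by apply/asboolP.
  move=> a x y /asboolP Qx /asboolP Qy; apply/asboolP.
  by apply: QD => //; apply: QM.
pose I : idealr A := HB.pack_for (idealr A) S (isIdealr.Build A S S_ideal).
pose R : comNzRingType := {ideal_quot I}.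
have [pi pi_surj pi_eq0] : exists2 pi : {rmorphism A -> R},
    forall u, exists a, u = pi a & forall a, Q a -> pi a = 0.
  exists (\pi_R)%qT.
    by move=> u; exists (generic_quotient.repr u); rewrite /= generic_quotient.reprK.
  move=> a Qa; rewrite -[RHS](rmorph0 (\pi_R)%qT); apply/eqP.
  by rewrite -Quotient.idealrBE subr0; apply/asboolP.
have inv_ex (x : R) : exists y, x != 0 -> y * x = 1.
  have [->|x_neq0] := eqVneq x 0; first by exists 0 => /eqP.
  have [a eq_x] := pi_surj x; have [b eq_a] := flatA a.
  exists (pi b) => _; rewrite eq_x -rmorphM; apply/eqP.
  rewrite eq_sym -subr_eq0 -(rmorph1 pi) -rmorphB; apply/eqP.
  have : Q (a * (1 - b * a)).
    by rewrite mulrBr mulr1 mulrA mulrAC -eq_a subrr.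
  move=> /Qmul [/pi_eq0 a0|/pi_eq0 //].
  by rewrite eq_x a0 eqxx in x_neq0.
have [inv0 inv0P] := choice inv_ex.
pose inv x := if x == 0 then 0 else inv0 x.
have invV x : x != 0 -> inv x * x = 1.
  by move=> x_neq0; rewrite /inv (negPf x_neq0) inv0P.
have inv_0 : inv 0 = 0 by rewrite /inv eqxx.
pose K : fieldType := HB.pack_for fieldType R
  (GRing.ComNzRing_isField.Build R invV inv_0).
by exists K, pi.
Qed.

Section FunctionRing.
Variables (gT : finGroupType) (K : fieldType).

(** This alias carries the nonzero commutative ring structure, where 0 and 1 differ because the
    group has an element. *)
Definition fun_ring := {ffun gT -> K}.

HB.instance Definition _ := GRing.PzRing.on fun_ring.
HB.instance Definition _ :=
  GRing.PzSemiRing_isNonZero.Build fun_ring (@ffun1_nonzero gT K 1%g).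
HB.instance Definition _ :=
  GRing.PzSemiRing_hasCommutativeMul.Build fun_ring (@ffun_mulC gT K).

Local Notation shift := (@fun_act gT K : gT -> fun_ring -> fun_ring).

Lemma fun_ring_eval_hom t : ring_hom (fun f : fun_ring => f t).
Proof. by split=> [x y|x y|]; exact: ffunE. Qed.

Lemma fun_ring_hom (R : comNzRingType) (F : R -> fun_ring) :
  (forall t, ring_hom (fun x => F x t)) -> ring_hom F.
Proof.
move=> hF; split=> [x y|x y|]; apply/ffunP => t; have [hD hM h1] := hF t;
  have [eD eM e1] := fun_ring_eval_hom t.
- by rewrite hD eD.
- by rewrite hM eM.
- by rewrite h1 e1.
Qed.

Lemma fun_ring_action : diff_action shift.
Proof.
split=> [s|f|s t f].
- apply: fun_ring_hom => t; have [eD eM e1] := fun_ring_eval_hom (s^-1 * t)%g.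
  by split=> [x y|x y|]; rewrite !ffunE.
- by apply/ffunP => t; rewrite ffunE invg1 mul1g.
- by apply/ffunP => r; rewrite !ffunE invMg mulgA.
Qed.

Lemma fun_ring_pseudofield :
  pseudofield shift.
Proof.
have evM t (x y : fun_ring) : (x * y) t = x t * y t by have [] := fun_ring_eval_hom t.
split=> [f|I [[I0 ID IM] I_act]].
  exists [ffun t => (f t)^-1]; apply/ffunP => t; rewrite !evM ffunE.
  have [->|ft_neq0] := eqVneq (f t) 0; first by rewrite !mul0r.
  by rewrite mulfK.
have [|/existsNP [f]] := pselect (forall f, I f -> f = 0); first by left.
move=> /not_implyP [If /eqP f_neq0]; right=> g.
have [t ft] : exists t, f t != 0.
  apply: contrapT => /forallNP f0; case/eqP: f_neq0; apply/ffunP => t.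
  by rewrite ffunE; apply/eqP; apply: contrapT => /negP /f0.
pose e (s : gT) (u : K) : fun_ring := [ffun r => if r == s then u else 0].
(* Multiplying [f] by a function supported at [t] isolates one value, and translation by [s * t^-1]
   moves it to [s]. *)
have Ie s u : I (e s u).
  have -> : e s u = fun_act (s * t^-1)%g (e t (u / f t) * f).
    apply/ffunP => r; rewrite !ffunE invMg invgK -mulgA.
    have -> : (t * (s^-1 * r) == t)%g = (r == s).
      by rewrite -[X in _ == X]mulg1 (inj_eq (mulgI t)) -eq_mulVg1 eq_sym.
    by case: eqP => [->|_]; rewrite ?mul0r // mulVg mulg1 divfK.
  by apply: I_act; apply: IM.
have -> : g = \sum_s e s (g s).
  apply/ffunP => t'; have [F eF] := ring_homP (fun_ring_eval_hom t').
  rewrite -[RHS]/((fun f : fun_ring => f t') _) eF rmorph_sum (bigD1 t') //= -eF.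
  rewrite ffunE eqxx big1 ?addr0 // => s neq_s.
  by rewrite ffunE eq_sym (negPf neq_s).
by apply: (big_ind I).
Qed.

Section Coinduction.
Variables (A : comNzRingType) (act : gT -> A -> A) (pi : {rmorphism A -> K}).
Hypothesis Hact : diff_action act.

(** The only equivariant map to [fun_ring] whose value at 1 is [pi]. *)
Definition coinduce (a : A) : fun_ring := [ffun t => pi (act t^-1%g a)].

Lemma coinduce_diff_hom : diff_hom act shift coinduce.
Proof.
have [hact _ actM] := Hact; split=> [|s a].
  apply: fun_ring_hom => t; have [F eF] := ring_homP (hact t^-1%g).
  rewrite /coinduce; split=> [x y|x y|].
  - by rewrite !ffunE eF !rmorphD.
  - by rewrite !ffunE eF !rmorphM.
  - by rewrite !ffunE eF !rmorph1.
by apply/ffunP => t; rewrite !ffunE -actM invMg invgK.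
Qed.

(* The generator is the function supported at 1 with value [z]: its translate
   by [s] is supported at [s], so it picks out the factor indexed by [s]. *)
Lemma coinduce_gen1 (z : K) :
  z != 0 -> (forall u, exists q : {poly A}, u = (map_poly pi q).[z]) ->
  diff_gen1 act shift coinduce.
Proof.
move=> z_neq0 gen_z; have [hact act1 actM] := Hact.
pose theta (_ : 'I_1) : fun_ring := [ffun t => if t == 1%g then z else 0].
have [hco co_act] := coinduce_diff_hom.
pose psi : dpoly gT A 1 -> fun_ring := dpeval shift coinduce theta.
have hpsi : ring_hom psi by apply: dpeval_ring_hom.
exists psi; split=> [|a|g].
- split=> // s f; apply: dpeval_dpact => //; exact: fun_ring_action.
- exact: dpevalC.
have ev_psi t : exists F : {rmorphism dpoly gT A 1 -> K},
    (fun f => psi f t) = F.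
  by apply: ring_homP; apply: ring_hom_comp hpsi (fun_ring_eval_hom t).
have comp s : exists f, forall t, psi f t = if t == s then g s else 0.
  (* Dividing by [z] leaves room for the exponents [i.+1]: without a constant term, the sum vanishes
     away from [s]. The twist of the coefficients by [s] cancels the one made by [coinduce] at
     [s]. *)
  have [q eq_q] := gen_z (g s / z).
  exists (\sum_(i < size q) mconst _ (act s q`_i) * dy A s ord0 ^+ i.+1) => t.
  have [F eF] := ev_psi t; rewrite -[LHS]/((fun f => psi f t) _) eF rmorph_sum.
  have FC a : F (mconst _ a) = pi (act t^-1%g a).
    by rewrite -eF /psi dpevalC // ffunE.
  have FX : F (dy A s ord0) = if t == s then z else 0.
    by rewrite -eF /psi dpevalX // !ffunE -eq_mulVg1 eq_sym.
  under eq_bigr => i _ do rewrite rmorphM rmorphXn FC FX /=.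
  case: eqP => [->|_]; last by rewrite big1 // => i _; rewrite expr0n mulr0.
  rewrite -[g s](divfK z_neq0) eq_q (horner_coef_wide z (size_poly _ _)) mulr_suml.
  apply: eq_bigr => i _.
  by rewrite coef_map -actM mulVg act1 exprSr mulrA.
have [f fE] := choice comp.
exists (\sum_s f s); apply/ffunP => t.
have [F eF] := ev_psi t; rewrite -[LHS]/((fun f => psi f t) _) eF rmorph_sum.
rewrite (bigD1 t) //= -eF fE eqxx big1 ?addr0 // => s neq_s.
by rewrite fE eq_sym (negPf neq_s).
Qed.

End Coinduction.
End FunctionRing.

(** * Algebraic closedness of the residue field *)

Lemma residue_surj_of_simple_extension (gT : finGroupType) (A : comNzRingType)
    (act : gT -> A -> A) (K : fieldType) (pi : {rmorphism A -> K}) (z : K) :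
  diff_action act ->
  (forall (B : comNzRingType) (actB : gT -> B -> B) (phi : A -> B),
     diff_action actB -> diff_hom act actB phi -> pseudofield actB ->
     diff_gen1 act actB phi -> bijective phi) ->
  z != 0 -> (forall u, exists q : {poly A}, u = (map_poly pi q).[z]) ->
  bijective (coinduce act pi) /\ forall u, exists a, u = pi a.
Proof.
move=> Hact all_bij z_neq0 gen_z; have [_ act1 _] := Hact.
have bij : bijective (coinduce act pi).
  apply: (all_bij _ (@fun_act gT K : gT -> fun_ring gT K -> fun_ring gT K)).
  - exact: fun_ring_action.
  - exact: coinduce_diff_hom.
  - exact: fun_ring_pseudofield.
  - exact: coinduce_gen1 gen_z.
(* A preimage of the constant function [u], read at 1, is a preimage of [u] under [pi]. *)
split=> // u; have [g _ gK] := bij; exists (g [ffun=> u]).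
by have := congr1 (fun f : fun_ring gT K => f 1%g) (gK [ffun=> u]); rewrite !ffunE invg1 act1.
Qed.

(** An irreducible [p] has a root generating a simple extension, and this root lies in [K] by
    hypothesis; a reducible [p] inherits a root from a proper factor, by induction on the size. *)
Lemma root_of_trivial_simple_extensions (K : fieldType) (p : {poly K}) :
  (forall (L : fieldExtType K) (z : L), z != 0 -> <<1; z>>%VS = fullv ->
     exists x : K, z = x%:A) ->
  (1 < size p)%N -> exists x, root p x.
Proof.
move=> triv; have [n] := ubnP (size p); elim: n p => // n IHn p lt_p p_gt1.
have p_neq0 : p != 0 by rewrite -size_poly_gt0 ltnW.
have [irr_p|red_p] := pselect (irreducible_poly p).
  have [L _ [z pz0 genz]] := irredp_FAdjoin irr_p.
  have [x eq_z] : exists x : K, z = x%:A.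
    have [->|z_neq0] := eqVneq z 0; first by exists 0; rewrite scale0r.
    exact: triv z_neq0 genz.
  by exists x; rewrite -(fmorph_root (in_alg L)) /= -eq_z.
have [q [q_neq1 q_dvd q_neq]] : exists q : {poly K},
    [/\ size q != 1%N, (q %| p)%R & ~~ (q %= p)%R].
  apply: contrapT => /forallNP no_q; apply: red_p; split=> // q q_neq1 q_dvd.
  by apply: contrapT => /negP q_neq; apply: (no_q q).
have q_neq0 : q != 0.
  by apply: contraTneq q_dvd => ->; rewrite dvd0p.
have q_gt1 : (1 < size q)%N by rewrite ltn_neqAle eq_sym q_neq1 size_poly_gt0.
have lt_qp : (size q < size p)%N.
  by rewrite ltn_neqAle dvdp_size_eqp // q_neq dvdp_leq.
have [x qx0] := IHn q (leq_trans lt_qp lt_p) q_gt1.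
by exists x; have /dvdpP [r ->] := q_dvd; rewrite rootM qx0 orbT.
Qed.

Lemma gen1_trivial_fun_iso (gT : finGroupType) (A : comNzRingType)
    (act : gT -> A -> A) :
  diff_action act -> pseudofield act ->
  (forall (B : comNzRingType) (actB : gT -> B -> B) (phi : A -> B),
     diff_action actB -> diff_hom act actB phi -> pseudofield actB ->
     diff_gen1 act actB phi -> bijective phi) ->
  exists (K : closedFieldType) (iso : A -> {ffun gT -> K}), fun_iso act iso.
Proof.
move=> Hact [flatA _] all_bij.
have id0 : is_ideal (fun x : A => x = 0).
  by split=> [//|x y -> ->|r x ->]; rewrite ?addr0 ?mulr0.
have rad0 : ~ radical (fun x : A => x = 0) 1.
  by case=> k /eqP; rewrite expr1n oner_eq0.
have [Q [primeQ _ _]] := prime_ideal_avoiding id0 rad0.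
(* The field is opened so that the closed field structure can later be put on the same carrier
   [T]. *)
have [[T cT] [pi pi_surj]] := abs_flat_residue_field flatA primeQ.
pose K := GRing.Field.Pack cT.
have [bij _] : bijective (coinduce act pi) /\ forall u, exists a, u = pi a.
  apply: (residue_surj_of_simple_extension Hact all_bij (oner_neq0 K)) => u.
  by have [a ->] := pi_surj u; exists a%:P; rewrite map_polyC hornerC.
have triv (L : fieldExtType K) (z : L) : z != 0 -> <<1; z>>%VS = fullv ->
    exists x : K, z = x%:A.
  move=> z_neq0 genz; pose piL : {rmorphism A -> L} := in_alg L \o pi.
  have [|_ piL_surj] := residue_surj_of_simple_extension (pi := piL) Hact all_bij z_neq0.
    (* An element of [L] is a polynomial in [z] over [K], whose coefficients lift to [A] along the
       surjection [pi]. *)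
    move=> u; have zu : u \in <<1; z>>%VS by rewrite genz memvf.
    have /polyOver1P [q eq_q] := Fadjoin_polyOver 1 z u.
    have [s sP] := choice pi_surj.
    exists (\poly_(i < size q) s q`_i); rewrite -{1}(Fadjoin_poly_eq zu) eq_q.
    congr (_.[z]); apply/polyP => i; rewrite !coef_map coef_poly /=.
    by case: ltnP => [_|le_i]; rewrite -?sP // nth_default // rmorph0.
  by have [a eq_z] := piL_surj z; exists (pi a).
have closedK : GRing.closed_field_axiom K.
  move=> n P n_gt0; pose p := 'X^n - \poly_(i < n) P i.
  have sz_p : size p = n.+1.
    by rewrite size_polyDl size_polyXn // size_polyN ltnS size_poly.
  have [|x] := root_of_trivial_simple_extensions (p := p) triv.
    by rewrite sz_p ltnS.
  rewrite /root hornerD hornerN hornerXn subr_eq0 => /eqP eq_x; exists x.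
  rewrite eq_x (horner_coef_wide x (size_poly _ _)).
  by apply: eq_bigr => i _; rewrite coef_poly ltn_ord.
pose Kcl := Field_isAlgClosed.Build K closedK.
pose K' : closedFieldType := HB.pack_for closedFieldType T K Kcl.
exists K', (coinduce act pi).
have [[coD coM co1] co_act] := coinduce_diff_hom pi Hact.
split=> //.
- by move=> x y t; rewrite coD ffunE.
- by move=> x y t; rewrite coM ffunE.
- by move=> t; rewrite co1 ffunE.
Qed.

Theorem theorem4p12 (gT : finGroupType) (A : comNzRingType)
  (act : gT -> A -> A) (Hact : diff_action act) (HA : pseudofield act) :
  [<-> diff_closed act;
       forall (B : comNzRingType) (actB : gT -> B -> B) (phi : A -> B),
         diff_action actB -> diff_hom act actB phi -> pseudofield actB ->
         diff_fin_gen act actB phi -> bijective phi;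
       forall (B : comNzRingType) (actB : gT -> B -> B) (phi : A -> B),
         diff_action actB -> diff_hom act actB phi -> pseudofield actB ->
         diff_gen1 act actB phi -> bijective phi;
       exists (K : closedFieldType) (iso : A -> {ffun gT -> K}),
         [/\ bijective iso,
             forall x y t, iso (x + y) t = iso x t + iso y t,
             forall x y t, iso (x * y) t = iso x t * iso y t,
             forall t, iso 1 t = 1 &
             forall s x, iso (act s x) = fun_act s (iso x)]].
Proof.
tfae.
- by move=> closedA B actB phi HactB Hphi HB; apply: diff_closed_fin_gen_bij.
- move=> fin_bij B actB phi HactB Hphi HB gen1.
  by apply: fin_bij HactB Hphi HB _; exists 1%N.
- exact: gen1_trivial_fun_iso.
- by move=> [K [iso iso_K]]; apply: fun_iso_diff_closed iso_K.
Qed.
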